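(* Let $G$ be a finite simple graph that is prime and contains no induced subgraph isomorphic to $P_5$, $\overline{P_5}$, or $C_5$, and suppose $G$ contains an induced subgraph isomorphic to $\overline{C_4}$. Then there are pairwise disjoint subsets $X_0, X_1, \ldots, X_m, Y_0, Y_1, \ldots, Y_m$ of $V(G)$, with $m\ge 2$, whose union is $V(G)$, such that, writing $X=X_0\cup X_1\cup\cdots\cup X_m$ and $Y=Y_0\cup Y_1\cup\cdots\cup Y_m$, the following hold: (1) For each $i\in\{1,\ldots,m\}$, $G[X_i]$ is connected and $|X_i|\ge 2$; $X_0$ is a (possibly empty) stable set; and $X_0,X_1,\ldots,X_m$ are pairwise anticomplete to each other. (2) For each $i\in\{1,\ldots,m\}$, $Y_i\neq\emptyset$, and every vertex of $Y_i$ is mixed on $X_i$ and complete to $X\setminus(X_i\cup X_0)$; and $Y_0$ is complete to $X\setminus X_0$. (3) $Y_0,Y_1,\ldots,Y_m$ are pairwise complete to each other (so each anticomponent of $Y$ is included in some $Y_i$, $i\in\{0,\ldots,m\}$). (4) No vertex of $X\setminus X_0$ is mixed on any anticomponent of $Y$. (5) For each $i\in\{1,\ldots,m\}$, $X_i$ contains a vertex that is complete to $Y$. (6) Every vertex of $X_0$ is mixed on at most one anticomponent of $Y$. (7) For every big anticomponent $Z$ of $Y$, the set $X_Z$ of vertices of $X_0$ that are mixed on $Z$ is non-empty; moreover, if $Z$ and $Z'$ are two distinct big anticomponents of $Y$, then $X_Z\cap X_{Z'}=\emptyset$. (8) Each big anticomponent $Z$ of $Y$ contains a vertex that is anticomplete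 to $X_Z$. (9) If $Y$ is not a clique, then there is a big anticomponent $Z$ of $Y$ such that $X_Z$ is anticomplete to all big anticomponents of $Y\setminus Z$.
   Context: $P_n$ is the path on $n$ vertices, $C_n$ the cycle on $n$ vertices, $\overline{H}$ the complement of $H$, and $G[S]$ the subgraph induced by $S$. For $S\subseteq V(G)$ and $v\in V(G)\setminus S$: $v$ is complete to $S$ if adjacent to all of $S$, anticomplete to $S$ if adjacent to none of $S$, and mixed on $S$ if neither. Sets $S,T$ disjoint: $S$ is complete (anticomplete) to $T$ if every vertex of $S$ is complete (anticomplete) to $T$. An anticomponent of a set $S\subseteq V(G)$ is a subset of $S$ whose vertex set induces a connected component of $\overline{G}[S]$. A set is big if it has at least two vertices. A homogeneous set is a non-empty $S\subseteq V(G)$ such that every vertex of $V(G)\setminus S$ is complete or anticomplete to $S$; it is proper if $|S|\ge 2$ and $S\ne V(G)$. A graph is prime if it has no proper homogeneous set. *)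

(* Defs.v *)
From mathcomp Require Import all_boot.

Set Implicit Arguments.
Unset Strict Implicit.
Unset Printing Implicit Defensive.

(* A finite simple graph is a symmetric irreflexive relation [e : rel V] on a
   finType V; the definitions below are only meant for such relations.        *)

Definition complement (V : finType) (e : rel V) : rel V :=
  [rel x y | (x != y) && ~~ e x y].

Definition path_graph (n : nat) : rel 'I_n :=
  [rel i j : 'I_n | (i.+1 == j :> nat) || (j.+1 == i :> nat)].

(* [ordS] is the cyclic successor of 'I_n; this is C_n for n >= 3. *)
Definition cycle_graph (n : nat) : rel 'I_n :=
  [rel i j : 'I_n | (ordS i == j) || (ordS j == i)].

(* e has an induced subgraph isomorphic to h. *)
Definition contains_induced (U V : finType) (h : rel U) (e : rel V) : Prop :=
  exists f : U -> V, injective f /\ forall x y, e (f x) (f y) = h x y.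

Section Graph.
Variables (V : finType) (e : rel V).
Implicit Types (S T Z : {set V}) (v x : V).

Definition complete_to v S : bool := [forall x in S, e v x].
Definition anticomplete_to v S : bool := [forall x in S, ~~ e v x].

(* Only used for v \notin S. *)
Definition mixed_on v S : bool := ~~ complete_to v S && ~~ anticomplete_to v S.

Definition set_complete S T : bool := [forall x in S, complete_to x T].
Definition set_anticomplete S T : bool := [forall x in S, anticomplete_to x T].

Definition stable S : bool := [forall x in S, forall y in S, ~~ e x y].
Definition clique S : bool := [forall x in S, forall y in S, (x != y) ==> e x y].

Definition big S : bool := 2 <= #|S|.

Definition homogeneous S : bool :=
  (S != set0) && [forall v in ~: S, complete_to v S || anticomplete_to v S].
Definition proper_homogeneous S : bool :=
  [&& homogeneous S, 2 <= #|S| & S != [set: V]].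
Definition prime_graph : Prop := forall S, ~~ proper_homogeneous S.

(* Edges with both ends in S; [connect (induced S)] is reachability in the
   induced subgraph on S when restricted to vertices of S.                    *)
Definition induced S : rel V := [rel x y | [&& x \in S, y \in S & e x y]].

Definition connected_on S : bool :=
  (S != set0) && [forall x in S, forall y in S, connect (induced S) x y].

Definition components S : {set {set V}} :=
  equivalence_partition (connect (induced S)) S.

(* For A = X_0, this is the set X_Z. *)
Definition mixed_part (A Z : {set V}) : {set V} := [set x in A | mixed_on x Z].

End Graph.

Definition anticomponents (V : finType) (e : rel V) (S : {set V}) :
  {set {set V}} := components (complement e) S.

(* Main.v *)
Require Import Defs.
From mathcomp Require Import all_boot.

Set Implicit Arguments.
Unset Strict Implicit.
Unset Printing Implicit Defensive.

(** Take [X] maximal such that [G[X]] has two big components, let [X_1, ..., X_m]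
    be its big components, [X_0] its isolated vertices and [Y] the complement of
    [X].  By maximality every [y] in [Y] has a neighbour in each [X_i] with
    [i >= 1], and P5-freeness makes [y] mixed on at most one of them; this defines
    the [Y_i].  A vertex of [X_i] complete to [Y] is one with the most neighbours
    in [Y], and a vertex of [Z] anticomplete to [X_Z] is one with the fewest
    neighbours in [X_Z].  For the last clause, write [Z -> Z'] when some vertex of
    [X_Z] is complete to [Z']: since the house (the complement of P5) is excluded,
    this is a strict order on the big anticomponents of [Y], and a sink of it has
    the required property. *)

(** * Edge cuts, reachability and components *)

Lemma connect_cut (T : finType) (r : rel T) (P : pred T) x y :
  connect r x y -> P x -> ~~ P y -> exists u v, [/\ r u v, P u & ~~ P v].
Proof.
case/connectP=> p; elim: p x => [|z p IHp] x /=.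
  by move=> _ -> Px; rewrite Px.
case/andP=> rxz pz ylast Px nPy; case Pz: (P z); first exact: IHp pz ylast Pz nPy.
by exists x, z; rewrite rxz Px Pz.
Qed.

Section Components.
Variables (T : finType) (r : rel T).
Hypothesis r_sym : symmetric r.
Implicit Types S Z : {set T}.

Lemma induced_connect_sym S : connect_sym (induced r S).
Proof. by apply: sym_connect_sym => x y; rewrite /induced /= r_sym andbCA. Qed.

Lemma componentsP S Z :
  reflect (exists2 x, x \in S & Z = [set y in S | connect (induced r S) x y])
          (Z \in components r S).
Proof. exact: imsetP. Qed.

Lemma component_sub S Z x : Z \in components r S -> x \in Z -> x \in S.
Proof. by case/componentsP=> w _ ->; rewrite inE => /andP[]. Qed.

Lemma component_neq0 S Z : Z \in components r S -> exists x, x \in Z.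
Proof. by case/componentsP=> w wS ->; exists w; rewrite inE wS connect0. Qed.

Lemma component_of S x :
  x \in S -> exists2 Z, Z \in components r S & x \in Z.
Proof.
move=> xS; exists [set y in S | connect (induced r S) x y].
  by apply/componentsP; exists x.
by rewrite inE xS connect0.
Qed.

Lemma component_connect S Z x y : Z \in components r S -> x \in Z ->
  (y \in Z) = (y \in S) && connect (induced r S) x y.
Proof.
case/componentsP=> w _ ->; rewrite !inE => /andP[_ wx].
by rewrite (same_connect (induced_connect_sym S) wx).
Qed.

Lemma component_inj S Z Z' x : Z \in components r S ->
  Z' \in components r S -> x \in Z -> x \in Z' -> Z = Z'.
Proof.
move=> ZS ZS' xZ xZ'; apply/setP=> y.
by rewrite (component_connect _ ZS xZ) (component_connect _ ZS' xZ').
Qed.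

Lemma component_closed S Z u v :
  Z \in components r S -> u \in Z -> v \in S -> r u v -> v \in Z.
Proof.
move=> ZS uZ vS ruv; rewrite (component_connect _ ZS uZ) vS connect1 //.
by rewrite /induced /= (component_sub ZS uZ) vS.
Qed.

(** With [P] the adjacency to a fixed vertex, this yields an edge of [Z] between a neighbour and a
    non-neighbour of it. Every forbidden subgraph built on mixedness starts from such an edge, or
    from such a non-edge when [r] is the complement. *)
Lemma component_cut S Z (P : pred T) x y : Z \in components r S ->
  x \in Z -> y \in Z -> P x -> ~~ P y ->
  exists u v, [/\ u \in Z, v \in Z, r u v, P u & ~~ P v].
Proof.
move=> ZS xZ yZ Px nPy.
have: connect (induced r S) x y.
  by move: yZ; rewrite (component_connect _ ZS xZ) => /andP[].
case/(connect_cut (P := fun z => (z \in Z) && P z)); first by rewrite xZ.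
  by rewrite yZ.
move=> u [v [/and3P[uS vS ruv] /andP[uZ Pu] nPv]]; exists u, v.
by move: nPv; rewrite (component_closed ZS uZ vS ruv).
Qed.

Lemma component_connected S Z : Z \in components r S -> connected_on r Z.
Proof.
move=> ZS; have [w wZ] := component_neq0 ZS; apply/andP; split.
  by apply/set0Pn; exists w.
apply/forall_inP=> x xZ; apply/forall_inP=> y yZ; apply/negPn/negP=> nxy.
have [u [v [uZ vZ ruv xu /negP[]]]] :=
  component_cut (P := connect (induced r Z) x) ZS xZ yZ (connect0 _ x) nxy.
by apply: connect_trans xu (connect1 _); rewrite /induced /= uZ vZ.
Qed.

Lemma big_component_nbr S Z x :
  Z \in components r S -> big Z -> x \in Z -> exists2 y, y \in Z & r x y.
Proof.
move=> ZS bZ xZ; have [y yZ nxy] : exists2 y, y \in Z & y != x.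
  move: bZ; rewrite /big (cardsD1 x) xZ => /card_gt0P[y].
  by rewrite !inE => /andP[nyx yZ]; exists y.
have [u [v [uZ vZ ruv /eqP<- _]]] :=
  component_cut (P := pred1 x) ZS xZ yZ (eqxx x) nxy.
by exists v.
Qed.

Lemma big_component_of_edge S x y : irreflexive r ->
  x \in S -> y \in S -> r x y ->
  exists Z, [/\ Z \in components r S, big Z, x \in Z & y \in Z].
Proof.
move=> r_irr xS yS rxy; have [Z ZS xZ] := component_of xS.
have yZ := component_closed ZS xZ yS rxy; exists Z; split=> //.
rewrite /big (cardsD1 x) xZ; apply/card_gt0P; exists y; rewrite !inE yZ andbT.
by apply: contraTneq rxy => ->; rewrite r_irr.
Qed.

End Components.

Lemma complement_sym (V : finType) (e : rel V) :
  symmetric e -> symmetric (complement e).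
Proof. by move=> e_sym x y; rewrite /complement /= eq_sym e_sym. Qed.

Lemma complement_irr (V : finType) (e : rel V) : irreflexive (complement e).
Proof. by move=> x; rewrite /complement /= eqxx. Qed.

(** Compares the anticomponents of [Y :\: Z] with those of [Y] in the last clause of the theorem. *)
Lemma component_subset (T : finType) (r : rel T) (A S Z : {set T}) :
  symmetric r -> A \subset S -> Z \in components r A ->
  exists2 W, W \in components r S & Z \subset W.
Proof.
move=> r_sym /subsetP sAS ZA; have [x xZ] := component_neq0 ZA.
have [W WS xW] := component_of r (sAS _ (component_sub ZA xZ)).
exists W => //; apply/subsetP=> y; rewrite (component_connect r_sym _ ZA xZ).
case/andP=> yA xy; rewrite (component_connect r_sym _ WS xW) (sAS _ yA) /=.
apply: connect_sub xy => u v /and3P[uA vA ruv]; apply: connect1.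
by rewrite /induced /= !sAS.
Qed.

(** * Recognising an induced path, 5-cycle or house *)

(** A map that preserves and reflects adjacency can only identify vertices with equal
    neighbourhoods. The path, the 5-cycle and the house have no such pair, so distinctness of the
    five images need never be checked. *)
Lemma contains_induced_twin_free (U V : finType) (h : rel U) (e : rel V)
    (f : U -> V) :
  (forall x y, h x =1 h y -> x = y) -> (forall x y, e (f x) (f y) = h x y) ->
  contains_induced h e.
Proof.
move=> twin_free ef; exists f; split=> // x y fxy.
by apply: twin_free => z; rewrite -!ef fxy.
Qed.

Section Forbidden.
Variables (V : finType) (e : rel V).
Hypotheses (e_sym : symmetric e) (e_irr : irreflexive e).

Definition quintuple (a b c d f : V) (i : 'I_5) := tnth [tuple a; b; c; d; f] i.

Lemma no_induced_P5 a b c d f : ~ contains_induced (@path_graph 5) e ->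
  e a b -> e b c -> e c d -> e d f ->
  ~~ e a c -> ~~ e a d -> ~~ e a f -> ~~ e b d -> ~~ e b f -> ~~ e c f -> False.
Proof.
move=> noP5 ab bc cd df /negPf ac /negPf ad /negPf af /negPf bd /negPf bf
  /negPf cf; apply: noP5.
apply: (@contains_induced_twin_free _ _ _ _ (quintuple a b c d f)).
  move=> x y hxy; apply/val_inj.
  by move: (hxy (inord 0)) (hxy (inord 1)) (hxy (inord 2)) (hxy (inord 3))
     (hxy (inord 4)); case: x y {hxy} => [[|[|[|[|[|i]]]]] //= ?]
     [[|[|[|[|[|i']]]]] //= ?]; rewrite /path_graph /= !inordK.
case=> [[|[|[|[|[|i]]]]] //= ?] [[|[|[|[|[|i']]]]] //= ?];
  by rewrite /quintuple !(tnth_nth a) /path_graph /= ?e_irr // e_sym.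
Qed.

Lemma no_induced_C5 a b c d f : ~ contains_induced (@cycle_graph 5) e ->
  e a b -> e b c -> e c d -> e d f -> e f a ->
  ~~ e a c -> ~~ e a d -> ~~ e b d -> ~~ e b f -> ~~ e c f -> False.
Proof.
move=> noC5 ab bc cd df fa /negPf ac /negPf ad /negPf bd /negPf bf
  /negPf cf; apply: noC5.
apply: (@contains_induced_twin_free _ _ _ _ (quintuple a b c d f)).
  move=> x y hxy; apply/val_inj.
  by move: (hxy (inord 0)) (hxy (inord 1)) (hxy (inord 2)) (hxy (inord 3))
     (hxy (inord 4)); case: x y {hxy} => [[|[|[|[|[|i]]]]] //= ?]
     [[|[|[|[|[|i']]]]] //= ?]; rewrite /cycle_graph /= -?val_eqE /= !inordK.
case=> [[|[|[|[|[|i]]]]] //= ?] [[|[|[|[|[|i']]]]] //= ?];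
  by rewrite /quintuple !(tnth_nth a) /cycle_graph /= -?val_eqE /= ?e_irr //
    e_sym.
Qed.

(** The house is read as the square [a b c d] with a roof [f] on its edge [ab]. *)
Lemma no_induced_house a b c d f :
  ~ contains_induced (complement (@path_graph 5)) e ->
  e a b -> e b c -> e c d -> e d a -> e f a -> e f b ->
  ~~ e a c -> ~~ e b d -> ~~ e f c -> ~~ e f d -> False.
Proof.
move=> no_coP5 ab bc cd da fa fb /negPf ac /negPf bd /negPf fc /negPf fd.
apply: no_coP5.
(* In this order consecutive vertices are the four non-adjacent pairs, that is, the path of the
   complement. *)
apply: (@contains_induced_twin_free _ _ _ _ (quintuple a c f d b)).
  move=> x y hxy; apply/val_inj.
  by move: (hxy (inord 0)) (hxy (inord 1)) (hxy (inord 2)) (hxy (inord 3))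
     (hxy (inord 4)); case: x y {hxy} => [[|[|[|[|[|i]]]]] //= ?]
     [[|[|[|[|[|i']]]]] //= ?];
     rewrite /complement /path_graph /= -?val_eqE /= !inordK.
case=> [[|[|[|[|[|i]]]]] //= ?] [[|[|[|[|[|i']]]]] //= ?];
  by rewrite /quintuple !(tnth_nth a) /complement /path_graph /= -?val_eqE /=
    ?e_irr // e_sym.
Qed.

End Forbidden.

Ltac adjacency sym lem :=
  solve [ done | by rewrite sym | by apply: lem | by rewrite sym; apply: lem ].

(** * The big components of a maximal [X] and their neighbours in [Y] *)

Section Decomposition.
Variables (V : finType) (e : rel V).
Hypotheses (e_sym : symmetric e) (e_irr : irreflexive e).
Hypothesis noP5 : ~ contains_induced (@path_graph 5) e.
Hypothesis no_coP5 : ~ contains_induced (complement (@path_graph 5)) e.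
Hypothesis noC5 : ~ contains_induced (@cycle_graph 5) e.
Implicit Types (S W Z : {set V}) (x y z : V).

Lemma mixed_onP x S :
  reflect ((exists2 a, a \in S & e x a) /\ (exists2 b, b \in S & ~~ e x b))
          (mixed_on e x S).
Proof.
rewrite /mixed_on /complete_to /anticomplete_to !negb_forall_in.
apply: (iffP andP) => [[/exists_inP[b bS nb] /exists_inP[a aS]]|].
  by rewrite negbK => xa; split; [exists a | exists b].
case=> [[a aS xa] [b bS nxb]]; split; apply/exists_inP; first by exists b.
by exists a; rewrite ?negbK.
Qed.

(** A big component is witnessed by one of its edges, so two edges in different components suffice.
    The boolean form lets [maxset] apply. *)
Definition two_big_components S : bool :=
  [exists a, exists b, exists c, exists d,
     [&& induced e S a b, induced e S c d & ~~ connect (induced e S) a c]].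

Variable X : {set V}.
Hypothesis maxX : maxset two_big_components X.
Let B : {set {set V}} := [set Z in components e X | big Z].
Let Y : {set V} := ~: X.
Let X0 : {set V} := X :\: cover B.

Lemma bigcomp_component Z : Z \in B -> Z \in components e X.
Proof. by rewrite inE => /andP[]. Qed.

Lemma bigcomp_sub Z x : Z \in B -> x \in Z -> x \in X.
Proof. by move/bigcomp_component/component_sub; apply. Qed.

Lemma two_bigcomps : exists Z Z', [/\ Z \in B, Z' \in B & Z != Z'].
Proof.
have /existsP[a /existsP[b /existsP[c /existsP[d]]]] := maxsetp maxX.
case/and3P=> /and3P[aX bX ab] /and3P[cX dX cd] nac.
have [Z [ZX bZ aZ _]] := big_component_of_edge e_sym e_irr aX bX ab.
have [Z' [ZX' bZ' cZ' _]] := big_component_of_edge e_sym e_irr cX dX cd.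
exists Z, Z'; split; rewrite ?inE ?ZX ?ZX' //.
apply: contra nac => /eqP eqZ; move: cZ'.
by rewrite -eqZ (component_connect e_sym _ ZX aZ) => /andP[].
Qed.

Lemma card_bigcomps : 1 < #|B|.
Proof.
have [Z [Z' [ZB ZB' nZ]]] := two_bigcomps.
rewrite (cardsD1 Z) ZB; apply/card_gt0P; exists Z'.
by rewrite in_setD1 eq_sym nZ ZB'.
Qed.

Lemma other_bigcomp Z : exists2 Z', Z' \in B & Z != Z'.
Proof.
have [Z1 [Z2 [ZB1 ZB2 nZ]]] := two_bigcomps.
by case: (eqVneq Z Z1) => [->|nZ1]; [exists Z2 | exists Z1].
Qed.

Lemma bigcomp_anticomplete Z Z' x x' : Z \in B -> Z' \in B -> Z != Z' ->
  x \in Z -> x' \in Z' -> ~~ e x x'.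
Proof.
move=> ZB ZB' nZ xZ xZ'; apply: contra nZ => exx; apply/eqP.
apply: (component_inj e_sym (bigcomp_component ZB) (bigcomp_component ZB') _ xZ').
exact: (component_closed e_sym (bigcomp_component ZB) xZ (bigcomp_sub ZB' xZ')).
Qed.

Lemma bigcomp_edge Z x : Z \in B -> x \in Z -> exists2 x', x' \in Z & e x x'.
Proof.
by rewrite inE => /andP[ZX bZ]; apply: (big_component_nbr e_sym ZX bZ).
Qed.

Lemma isolated_anticomplete x z : x \in X0 -> z \in X -> ~~ e x z.
Proof.
rewrite inE => /andP[nx xX] zX; apply: contra nx => exz.
have [Z [ZX bZ xZ _]] := big_component_of_edge e_sym e_irr xX zX exz.
by apply/bigcupP; exists Z; rewrite // inE ZX.
Qed.

(** If [y] had no neighbour in [Z], adding it to [X] would leave [Z] a component, still separated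
    from an edge of another big component; this contradicts the maximality of [X]. *)
Lemma bigcomp_nbr Z y : Z \in B -> y \in Y -> exists2 x, x \in Z & e y x.
Proof.
move=> ZB; rewrite inE => yX; apply/exists_inP; apply: contraT.
rewrite negb_exists_in => /forall_inP noy.
have [Z' ZB' nZ] := other_bigcomp Z.
have [a aZ] := component_neq0 (bigcomp_component ZB).
have [c cZ'] := component_neq0 (bigcomp_component ZB').
have [b bZ ab] := bigcomp_edge ZB aZ; have [d dZ' cd] := bigcomp_edge ZB' cZ'.
have [_ maxXy] := maxsetP maxX; case/negP: yX.
suff <-: y |: X = X by rewrite setU11.
apply: (maxXy _ _ (subsetUr _ _)).
apply/existsP; exists a; apply/existsP; exists b.
apply/existsP; exists c; apply/existsP; exists d.
rewrite /induced /= !in_setU1 ab cd (bigcomp_sub ZB aZ) (bigcomp_sub ZB bZ).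
rewrite (bigcomp_sub ZB' cZ') (bigcomp_sub ZB' dZ') !orbT /=.
(* A path from [a] to [c] leaves [Z] by an edge, either to [y] or to a vertex of [X]; both are
   impossible. *)
apply/negP=> /(connect_cut (P := mem Z)); case=> //=.
  apply: contra nZ => cZ; apply/eqP.
  exact: (component_inj e_sym (bigcomp_component ZB) (bigcomp_component ZB') cZ).
move=> u [v [/and3P[_]]]; rewrite in_setU1 => /orP[/eqP->|vX] uv uZ.
  by case/negP: (noy u uZ); rewrite e_sym.
by case/negP; apply: (component_closed e_sym (bigcomp_component ZB) uZ vX uv).
Qed.

Lemma bigcomp_cut Z y a : Z \in B -> y \in Y -> a \in Z -> ~~ e y a ->
  exists u v, [/\ u \in Z, v \in Z, e u v, e y u & ~~ e y v].
Proof.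
move=> ZB yY aZ ya; have [b bZ yb] := bigcomp_nbr ZB yY.
exact: (component_cut e_sym (P := e y) (bigcomp_component ZB) bZ aZ yb ya).
Qed.

(** If [y] cut an edge [uv] of [Z] and an edge [u'v'] of [Z'], then [v u y u' v'] would be an
    induced path. Hence [y] is mixed on at most one big component. *)
Lemma nonnbr_once Z Z' y a b : Z \in B -> Z' \in B -> Z != Z' -> y \in Y ->
  a \in Z -> ~~ e y a -> b \in Z' -> e y b.
Proof.
move=> ZB ZB' nZ yY aZ ya bZ'; apply/negPn/negP=> yb.
have [u [v [uZ vZ uv yu yv]]] := bigcomp_cut ZB yY aZ ya.
have [u' [v' [uZ' vZ' uv' yu' yv']]] := bigcomp_cut ZB' yY bZ' yb.
have anti := bigcomp_anticomplete ZB ZB' nZ.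
apply: (@no_induced_P5 _ _ e_sym e_irr v u y u' v' noP5) => //;
  adjacency e_sym anti.
Qed.

(** Let [y] cut the edge [uv] of [Z], and let [c] be a common neighbour of [y] and [y'] in another
    big component. Without the edge [yy'], the square [u y' c y] with roof [v] on [uy'] is a house.
    This makes the [Y_i] pairwise complete. *)
Lemma mixed_complete_adj Z y y' a : Z \in B -> y \in Y -> y' \in Y ->
  a \in Z -> ~~ e y a -> {in Z, forall b, e y' b} -> e y y'.
Proof.
move=> ZB yY yY' aZ ya y'Z; apply/negPn/negP=> nyy.
have [u [v [uZ vZ uv yu yv]]] := bigcomp_cut ZB yY aZ ya.
have [Z' ZB' nZ] := other_bigcomp Z; have [c cZ' yc'] := bigcomp_nbr ZB' yY'.
have yc := nonnbr_once ZB ZB' nZ yY aZ ya cZ'.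
have anti := bigcomp_anticomplete ZB ZB' nZ.
apply: (@no_induced_house _ _ e_sym e_irr u y' c y v no_coP5) => //;
  first [adjacency e_sym anti | adjacency e_sym y'Z].
Qed.

(* Otherwise some [w] in [Z] is at distance 3 from [y] along a path [w u v y];
   a neighbour of [y] in another big component extends it to a P5. *)
Lemma nbr_toward Z y x : Z \in B -> y \in Y -> x \in Z -> ~~ e y x ->
  exists x', [/\ x' \in Z, e x x' & e y x'].
Proof.
move=> ZB yY xZ yx.
pose P w := e y w || [exists x' in Z, e w x' && e y x'].
suff: P x.
  by rewrite /P (negPf yx) => /exists_inP[x' xZ' /andP[? ?]]; exists x'.
apply/negPn/negP=> nPx; have [a aZ ya] := bigcomp_nbr ZB yY.
have Pa : P a by rewrite /P ya.
have [u [v [uZ vZ uv Pu]]] :=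
  component_cut e_sym (bigcomp_component ZB) aZ xZ Pa nPx.
rewrite negb_or negb_exists_in => /andP[yv /forall_inP nv].
have yu : ~~ e y u by move: (nv u uZ); rewrite e_sym uv.
move: Pu; rewrite /P (negPf yu) => /exists_inP[w wZ /andP[uw yw]].
have vw : ~~ e v w by move: (nv w wZ); rewrite yw andbT.
have [Z' ZB' nZ] := other_bigcomp Z.
have [c cZ'] := component_neq0 (bigcomp_component ZB').
have yc := nonnbr_once ZB ZB' nZ yY xZ yx cZ'.
have anti := bigcomp_anticomplete ZB ZB' nZ.
apply: (@no_induced_P5 _ _ e_sym e_irr v u w y c noP5) => //;
  adjacency e_sym anti.
Qed.

(** If [x] missed [y'], then [y] would also have a non-neighbour in [Z] by [mixed_complete_adj], so
    both would see a vertex [c] of another big component. With [w] in [Z] adjacent to [x] and [y'],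
    either [w y c y'] with roof [x] is a house or [x y c y' w] is an induced 5-cycle. *)
Lemma nonadj_same_nbr Z x y y' : Z \in B -> x \in Z -> y \in Y -> y' \in Y ->
  ~~ e y y' -> e x y -> e x y'.
Proof.
move=> ZB xZ yY yY' nyy xy; apply/negPn/negP=> xy'.
have yx' : ~~ e y' x by rewrite e_sym.
have [Z' ZB' nZ] := other_bigcomp Z.
have [c cZ'] := component_neq0 (bigcomp_component ZB').
have yc' := nonnbr_once ZB ZB' nZ yY' xZ yx' cZ'.
have [b bZ yb] : exists2 b, b \in Z & ~~ e y b.
  apply/exists_inP; rewrite -negb_forall_in; apply: contra nyy => /forall_inP yZ.
  by rewrite e_sym (mixed_complete_adj ZB yY' yY xZ yx').
have yc := nonnbr_once ZB ZB' nZ yY bZ yb cZ'.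
have [w [wZ xw yw']] := nbr_toward ZB yY' xZ yx'.
have anti := bigcomp_anticomplete ZB ZB' nZ.
case yw: (e y w).
  apply: (@no_induced_house _ _ e_sym e_irr w y c y' x no_coP5) => //;
    adjacency e_sym anti.
apply: (@no_induced_C5 _ _ e_sym e_irr x y c y' w noC5) => //;
  first [adjacency e_sym anti | by rewrite ?yw // e_sym yw].
Qed.

(** Let [x] have the most neighbours in [Y] and miss [y]. A vertex [x'] adjacent to [x] and [y] must
    miss some neighbour [y'] of [x]; then [y' y x' x] with roof [c] on [y'y], for [c] in another big
    component, is a house. *)
Lemma bigcomp_complete_vertex Z : Z \in B ->
  exists2 x, x \in Z & {in Y, forall y, e x y}.
Proof.
move=> ZB; have [x0 xZ0] := component_neq0 (bigcomp_component ZB).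
pose N x := [set y in Y | e x y].
have [x xZ maxx] : exists2 x, x \in Z & {in Z, forall x', #|N x'| <= #|N x|}.
  by case: (arg_maxnP (fun x => #|N x|) xZ0) => x xZ maxx; exists x.
exists x => // y yY; apply/negPn/negP=> xy.
have yx : ~~ e y x by rewrite e_sym.
have [x' [xZ' xx yx']] := nbr_toward ZB yY xZ yx.
have [y' yY' [xy' nxy']] : exists2 y', y' \in Y & e x y' /\ ~~ e x' y'.
  have: ~~ (N x \subset N x').
    apply/negP=> sN; have := maxx x' xZ'; rewrite leqNgt => /negP[].
    apply: proper_card; rewrite properE sN; apply/subsetPn; exists y.
      by rewrite inE yY e_sym.
    by rewrite inE yY.
  case/subsetPn=> y'; rewrite inE => /andP[yY' xy']; rewrite inE yY' => nxy'.
  by exists y'.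
have yy : e y' y.
  apply/negPn/negP=> nyy; case/negP: xy.
  exact: (nonadj_same_nbr ZB xZ yY' yY nyy xy').
have [Z' ZB' nZ] := other_bigcomp Z.
have [c cZ'] := component_neq0 (bigcomp_component ZB').
have yc := nonnbr_once ZB ZB' nZ yY xZ yx cZ'.
have yc' : e y' c by apply: (nonnbr_once ZB ZB' nZ yY' xZ' _ cZ'); rewrite e_sym.
have anti := bigcomp_anticomplete ZB ZB' nZ.
apply: (@no_induced_house _ _ e_sym e_irr y' y x' x c no_coP5) => //;
  adjacency e_sym anti.
Qed.

(** * Anticomponents of [Y] and the isolated vertices [X0] *)

Lemma anticomponent_complete W W' u v : W \in anticomponents e Y ->
  W' \in anticomponents e Y -> W != W' -> u \in W -> v \in W' -> e u v.
Proof.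
move=> WY WY' nW uW vW'; have co_sym := complement_sym e_sym.
apply/negPn/negP=> nuv; case/eqP: nW.
(* [~~ e u v] also holds for [u = v], which is no edge of the complement, so this case is
   separate. *)
have nW : u == v -> W = W'.
  by move/eqP=> uv; apply: (component_inj co_sym WY WY' uW); rewrite uv.
case: (boolP (u == v)) => [/nW //|neq_uv].
apply: (component_inj co_sym WY WY' _ vW').
apply: (component_closed co_sym WY uW (component_sub WY' vW')).
by rewrite /complement /= neq_uv.
Qed.

Lemma mixed_anticomponent W x : W \in anticomponents e Y -> mixed_on e x W ->
  exists u v, [/\ u \in W, v \in W, ~~ e u v, e x u & ~~ e x v].
Proof.
move=> WY /mixed_onP[[a aW xa] [b bW xb]].
have [u [v [uW vW /andP[_ uv] xu xv]]] :=
  component_cut (complement_sym e_sym) (P := e x) WY aW bW xa xb.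
by exists u, v.
Qed.

Lemma bigcomp_not_mixed Z x W : Z \in B -> x \in Z -> W \in anticomponents e Y ->
  ~~ mixed_on e x W.
Proof.
move=> ZB xZ WY; apply/negP=> /(mixed_anticomponent WY).
case=> u [v [uW vW uv xu /negP[]]].
by apply: (nonadj_same_nbr ZB xZ _ _ uv xu); apply: (component_sub WY).
Qed.

(** Non-edges [uv] of [W] and [u'v'] of [W'], both cut by [x], form the square [u u' v v'], with
    roof [x] on [uu']. *)
Lemma mixed_once W W' x : W \in anticomponents e Y ->
  W' \in anticomponents e Y -> mixed_on e x W -> mixed_on e x W' -> W = W'.
Proof.
move=> WY WY' mW mW'; apply/eqP; apply/negPn/negP=> nW.
have [u [v [uW vW uv xu xv]]] := mixed_anticomponent WY mW.
have [u' [v' [uW' vW' uv' xu' xv']]] := mixed_anticomponent WY' mW'.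
have com := anticomponent_complete WY WY' nW.
apply: (@no_induced_house _ _ e_sym e_irr u u' v v' x no_coP5) => //;
  adjacency e_sym com.
Qed.

(** By primeness some vertex outside [W] is mixed on [W]. It lies in no big component by
    [bigcomp_not_mixed], and in no other anticomponent of [Y] since those are complete to [W]; only
    [X0] remains. *)
Lemma big_anticomponent_mixed W : prime_graph e -> W \in anticomponents e Y ->
  big W -> mixed_part e X0 W != set0.
Proof.
move=> e_prime WY bW; have [Z ZB _] := other_bigcomp set0.
have [x xZ] := component_neq0 (bigcomp_component ZB).
have [w wW] := component_neq0 WY.
have WsubY u : u \in W -> u \notin X by move/(component_sub WY); rewrite inE.
have WT : W != [set: V].
  apply/eqP=> WT; have /WsubY/negP[] : x \in W by rewrite WT inE.
  exact: (bigcomp_sub ZB xZ).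
have := e_prime W; rewrite /proper_homogeneous WT andbT (_ : 1 < #|W|) ?andbT //.
rewrite /homogeneous negb_and negbK => /orP[/eqP W0|].
  by rewrite W0 inE in wW.
rewrite negb_forall_in => /exists_inP[v vW]; rewrite negb_or => mixv.
apply/set0Pn; exists v; rewrite !inE; rewrite inE in vW.
apply/andP; split=> //; case: (boolP (v \in X)) => vX.
  rewrite andbT; apply/negP=> /bigcupP[Z' ZB' vZ'].
  by have /negP[] := bigcomp_not_mixed ZB' vZ' WY.
have vY : v \in Y by rewrite inE.
have [W' WY' vW'] := component_of (complement e) vY.
have nW : W' != W by apply: contraNneq vW => <-.
case/andP: mixv => /negP[]; apply/forall_inP=> u uW.
exact: (anticomponent_complete WY' WY nW vW' uW).
Qed.

(* [nbr_toward] in the complement: the extending vertex of the antipath is one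
   that is complete to [Y]. *)
Lemma nonnbr_toward W x z a : W \in anticomponents e Y -> x \in X0 ->
  z \in W -> e x z -> a \in W -> ~~ e x a ->
  exists z', [/\ z' \in W, ~~ e z z' & ~~ e x z'].
Proof.
move=> WY xX zW xz aW xa.
pose P w := ~~ e x w || [exists w' in W, ~~ e w w' && ~~ e x w'].
suff: P z.
  by rewrite /P xz => /exists_inP[z' zW' /andP[? ?]]; exists z'.
apply/negPn/negP=> nPz; have Pa : P a by rewrite /P xa.
have [u [v [uW vW /andP[_ uv] Pu]]] :=
  component_cut (complement_sym e_sym) WY aW zW Pa nPz.
rewrite negb_or negbK negb_exists_in => /andP[xv /forall_inP nv].
have xu : e x u by move: (nv u uW); rewrite e_sym uv negbK.
move: Pu; rewrite /P xu => /exists_inP[w wW /andP[uw xw]].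
have vw : e v w by move: (nv w wW); rewrite xw andbT negbK.
have [Z ZB _] := other_bigcomp set0; have [c cZ cY] := bigcomp_complete_vertex ZB.
have {}cY : {in W, forall y, e c y} by move=> y yW; apply/cY/(component_sub WY).
have xc := isolated_anticomplete xX (bigcomp_sub ZB cZ).
(* The square is [c v x u], with roof [w] on [cv]. *)
apply: (@no_induced_house _ _ e_sym e_irr c v x u w no_coP5) => //;
  adjacency e_sym cY.
Qed.

(** Let [z] have the fewest neighbours in [X_W], one of them [x]. Some [z'] in [W] misses both [z]
    and [x], and by minimality sees some [x'] in [X_W] that [z] misses. With [c] complete to [Y],
    the path [x z c z' x'] is induced. *)
Lemma anticomponent_anticomplete_vertex W : W \in anticomponents e Y ->
  exists2 z, z \in W & anticomplete_to e z (mixed_part e X0 W).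
Proof.
move=> WY; have [z0 zW0] := component_neq0 WY.
pose N z := [set x in mixed_part e X0 W | e z x].
have [z zW minz] : exists2 z, z \in W & {in W, forall z', #|N z| <= #|N z'|}.
  by case: (arg_minnP (fun z => #|N z|) zW0) => z zW minz; exists z.
exists z => //; apply/forall_inP=> x xM; apply/negP=> zx.
have /andP[xX /mixed_onP[_ [a aW xa]]] : (x \in X0) && mixed_on e x W.
  by rewrite inE in xM.
have xz : e x z by rewrite e_sym.
have [z' [zW' zz xz']] := nonnbr_toward WY xX zW xz aW xa.
have [x' xX' [zx' nzx']] : exists2 x', x' \in X0 & e z' x' /\ ~~ e z x'.
  have: ~~ (N z' \subset N z).
    apply/negP=> sN; have := minz z' zW'; rewrite leqNgt => /negP[].
    apply: proper_card; rewrite properE sN; apply/subsetPn; exists x.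
      by rewrite inE xM.
    by rewrite inE xM e_sym.
  case/subsetPn=> x'; rewrite inE => /andP[xM' zx']; rewrite inE xM' => nzx'.
  by exists x' => //; move: xM'; rewrite inE => /andP[].
have [Z ZB _] := other_bigcomp set0; have [c cZ cY] := bigcomp_complete_vertex ZB.
have {}cY : {in W, forall y, e c y} by move=> y yW; apply/cY/(component_sub WY).
have X0X v : v \in X0 -> v \in X by case/setDP.
have anti := isolated_anticomplete _ (bigcomp_sub ZB cZ).
apply: (@no_induced_P5 _ _ e_sym e_irr x z c z' x' noP5) => //;
  first [adjacency e_sym cY | adjacency e_sym anti
        | apply: (isolated_anticomplete xX); exact: X0X].
Qed.

(** This is the transitivity of the order on anticomponents. If [x] missed [z], a non-edge [uv] of
    [W] cut by [x'] would give the square [u z v x] with roof [x'] on [uz]. *)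
Lemma nbr_inherit W x x' z : W \in anticomponents e Y -> x \in X0 -> x' \in X0 ->
  {in W, forall w, e x w} -> mixed_on e x' W -> z \in Y -> z \notin W ->
  e x' z -> e x z.
Proof.
move=> WY xX xX' xW mx' zY zW xz'; apply/negPn/negP=> xz.
have [u [v [uW vW uv xu xv]]] := mixed_anticomponent WY mx'.
have [W' WY' zW'] := component_of (complement e) zY.
have nW : W' != W by apply: contraNneq zW => <-.
have com := anticomponent_complete WY' WY nW zW'.
have xx : ~~ e x' x by case/setDP: xX => xX _; apply: isolated_anticomplete.
apply: (@no_induced_house _ _ e_sym e_irr u z v x x' no_coP5) => //;
  first [adjacency e_sym com | adjacency e_sym xW].
Qed.

(** The sink is a big anticomponent [W] with the fewest successors, collected in [out W]: a
    successor [W'] would have [out W'] properly contained in [out W]. *)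
Lemma anticomponent_mixed_part_anticomplete : ~~ clique e Y ->
  exists W, [/\ W \in anticomponents e Y, big W &
    forall W', W' \in anticomponents e Y -> big W' -> W != W' ->
      set_anticomplete e (mixed_part e X0 W) W'].
Proof.
rewrite negb_forall_in => /exists_inP[a aY]; rewrite negb_forall_in.
case/exists_inP=> b bY; rewrite negb_imply => co_ab.
have [W0 [WY0 bW0 _ _]] :=
  big_component_of_edge (complement_sym e_sym) (@complement_irr _ e) aY bY co_ab.
pose out W := [set W' in anticomponents e Y | big W' &
  [exists x in mixed_part e X0 W, complete_to e x W']].
pose bigY W := (W \in anticomponents e Y) && big W.
have W0P : bigY W0 by rewrite /bigY WY0.
case: (@arg_minnP _ _ bigY (fun W => #|out W|) W0P) => W /andP[WY bW] minW.
exists W; split=> // W' WY' bW' nW; apply/forall_inP=> x xM.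
have [xX mx] : x \in X0 /\ mixed_on e x W by move: xM; rewrite inE => /andP[].
apply/negPn/negP=> nanti.
(* Already mixed on [W], [x] cannot be mixed on [W'] too; having a neighbour there, it is complete
   to [W']. *)
have xW' : complete_to e x W'.
  apply/negPn/negP=> ncom; case/eqP: nW.
  by apply: (mixed_once WY WY' mx); rewrite /mixed_on ncom.
have WW' : W' \in out W by rewrite inE WY' bW'; apply/exists_inP; exists x.
have := minW W'; rewrite /bigY WY' bW' => /(_ isT); rewrite leqNgt => /negP[].
apply: proper_card; rewrite properE; apply/andP; split; last first.
  (* Irreflexivity: a vertex mixed on [W'] is not complete to it. *)
  apply/subsetPn; exists W' => //; rewrite inE WY' bW'.
  apply/exists_inP=> -[x']; rewrite inE => /andP[_ /andP[/negP]] //.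
apply/subsetP=> W2; rewrite !inE => /and3P[WY2 bW2 /exists_inP[x' xM' xW2]].
have [xX' mx'] : x' \in X0 /\ mixed_on e x' W'.
  by move: xM'; rewrite inE => /andP[].
rewrite WY2 bW2; apply/exists_inP; exists x => //.
apply/forall_inP=> z zW2.
have nW2 : W' != W2.
  by apply: contraTneq xW2 => <-; case/andP: mx'.
have zW' : z \notin W'.
  apply: contra nW2 => zW'; apply/eqP.
  exact: (component_inj (complement_sym e_sym) WY' WY2 zW' zW2).
apply: (nbr_inherit WY' xX xX' _ mx' (component_sub WY2 zW2) zW').
  exact: (forall_inP xW').
exact: (forall_inP xW2).
Qed.

End Decomposition.

(** * The starting pair of edges and the numbering of the parts *)

Lemma coC4_two_big_components (V : finType) (e : rel V) :
  contains_induced (complement (@cycle_graph 4)) e ->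
  exists S, two_big_components e S.
Proof.
case=> f [_ ef]; pose g k : V := f (inord k).
(* The complement of the 4-cycle consists of the disjoint edges [02] and [13]: distinct indices of
   equal parity. *)
have eg i j : i < 4 -> j < 4 -> e (g i) (g j) = (i != j) && ~~ odd (i + j).
  move=> lti ltj; rewrite ef /complement /cycle_graph /= -!val_eqE /= !inordK //.
  by case: i lti => [|[|[|[|i]]]] // _; case: j ltj => [|[|[|[|j]]]].
have gS k : g k \in [set f i | i : 'I_4] by apply: imset_f.
exists [set f i | i : 'I_4].
apply/existsP; exists (g 0); apply/existsP; exists (g 2).
apply/existsP; exists (g 1); apply/existsP; exists (g 3).
rewrite /induced /= !gS !eg //=; apply/negP.
(* On the four vertices, [P] selects the even indices. *)
pose P v := ~~ e (g 1) v && ~~ e (g 3) v.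
case/(connect_cut (P := P)); rewrite /P ?eg //.
move=> u [v [/and3P[/imsetP[i _ ->] /imsetP[j _ ->]]]].
rewrite -(inord_val i) -(inord_val j) -/(g i) -/(g j) !eg //.
by case: i j => [[|[|[|[|i]]]] // ?] [[|[|[|[|j]]]] // ?].
Qed.

(** Index [ord0] is reserved for [x0], which will be the stable part [X0]; the other indices number
    the big components. *)
Lemma indexed_from_one (T : finType) (A : {set T}) (x0 : T) :
  exists f : 'I_#|A|.+1 -> T,
    [/\ f ord0 = x0, forall i, i != ord0 -> f i \in A,
        forall i j, i != ord0 -> j != ord0 -> f i = f j -> i = j
      & forall x, x \in A -> exists2 i, i != ord0 & f i = x].
Proof.
exists (fun i => if unlift ord0 i is Some j then enum_val j else x0).
split=> [|i|i j|x xA]; first by rewrite unlift_none.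
- by case: (unliftP ord0 i) => [j ->|->] // _; rewrite enum_valP.
- case: (unliftP ord0 i) => [i' ->|->] //.
  case: (unliftP ord0 j) => [j' ->|->] //.
  by move=> _ _ /enum_val_inj->.
- exists (lift ord0 (enum_rank_in xA x)); first by rewrite eq_sym neq_lift.
  by rewrite liftK enum_rankK_in.
Qed.

(** * Assembly of the decomposition *)

Theorem theorem2p3 (V : finType) (e : rel V)
    (e_sym : symmetric e) (e_irr : irreflexive e)
    (e_prime : prime_graph e)
    (noP5 : ~ contains_induced (@path_graph 5) e)
    (no_coP5 : ~ contains_induced (complement (@path_graph 5)) e)
    (noC5 : ~ contains_induced (@cycle_graph 5) e)
    (has_coC4 : contains_induced (complement (@cycle_graph 4)) e) :
  exists (m : nat) (Xs Ys : 'I_m.+1 -> {set V}),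
    let X0 := Xs ord0 in
    let Y0 := Ys ord0 in
    let X := \bigcup_(i < m.+1) Xs i in
    let Y := \bigcup_(i < m.+1) Ys i in
    (2 <= m) /\
    (forall i j, i != j -> [disjoint Xs i & Xs j]) /\
    (forall i j, i != j -> [disjoint Ys i & Ys j]) /\
    (forall i j, [disjoint Xs i & Ys j]) /\
    (X :|: Y = [set: V]) /\
    (* (1) *)
    ((forall i, i != ord0 -> connected_on e (Xs i) /\ 2 <= #|Xs i|) /\
     stable e X0 /\
     (forall i j, i != j -> set_anticomplete e (Xs i) (Xs j))) /\
    (* (2) *)
    ((forall i, i != ord0 ->
        Ys i != set0 /\
        forall y, y \in Ys i ->
          mixed_on e y (Xs i) /\ complete_to e y (X :\: (Xs i :|: X0))) /\
     set_complete e Y0 (X :\: X0)) /\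
    (* (3) *)
    ((forall i j, i != j -> set_complete e (Ys i) (Ys j)) /\
     (forall Z, Z \in anticomponents e Y -> exists i, Z \subset Ys i)) /\
    (* (4) *)
    (forall x Z, x \in X :\: X0 -> Z \in anticomponents e Y ->
       ~~ mixed_on e x Z) /\
    (* (5) *)
    (forall i, i != ord0 -> exists2 x, x \in Xs i & complete_to e x Y) /\
    (* (6) *)
    (forall x, x \in X0 ->
       #|[set Z in anticomponents e Y | mixed_on e x Z]| <= 1) /\
    (* (7) *)
    ((forall Z, Z \in anticomponents e Y -> big Z ->
        mixed_part e X0 Z != set0) /\
     (forall Z Z', Z \in anticomponents e Y -> big Z ->
        Z' \in anticomponents e Y -> big Z' -> Z != Z' ->
        mixed_part e X0 Z :&: mixed_part e X0 Z' = set0)) /\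
    (* (8) *)
    (forall Z, Z \in anticomponents e Y -> big Z ->
       exists2 z, z \in Z & anticomplete_to e z (mixed_part e X0 Z)) /\
    (* (9) *)
    (~~ clique e Y ->
       exists Z, [/\ Z \in anticomponents e Y, big Z &
         forall Z', Z' \in anticomponents e (Y :\: Z) -> big Z' ->
           set_anticomplete e (mixed_part e X0 Z) Z']).
Proof.
have [X maxX] := ex_maxset (coC4_two_big_components has_coC4).
set B := [set Z in components e X | big Z].
set X0 := X :\: cover B; set Y := ~: X.
have [Xs [Xs0 XsB Xs_inj Xs_onto]] := indexed_from_one B X0.
(* For [i] nonzero, one non-neighbour in [Xs i] suffices as definition, since [bigcomp_nbr] always
   supplies a neighbour there. *)
pose Ys i := if i == ord0 then [set y in Y | [forall Z in B, complete_to e y Z]]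
             else [set y in Y | ~~ complete_to e y (Xs i)].
have Ys0 y : (y \in Ys ord0) = (y \in Y) && [forall Z in B, complete_to e y Z].
  by rewrite /Ys eqxx inE.
have YsE i y : i != ord0 ->
    (y \in Ys i) = (y \in Y) && ~~ complete_to e y (Xs i).
  by rewrite /Ys => /negPf->; rewrite inE.
clearbody Ys.
have XsX i x : x \in Xs i -> x \in X.
  case: (eqVneq i ord0) => [->|i0]; first by rewrite Xs0 => /setDP[].
  exact: (bigcomp_sub (XsB i i0)).
have YsY i y : y \in Ys i -> y \in Y.
  case: (eqVneq i ord0) => [->|i0]; first by rewrite Ys0 => /andP[].
  by rewrite (YsE _ _ i0) => /andP[].
have Xs_neq i j : i != ord0 -> j != ord0 -> i != j -> Xs i != Xs j.
  by move=> i0 j0; apply: contra => /eqP/(Xs_inj i j i0 j0)->.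
have coverB x : x \in X -> x \notin X0 -> exists2 i, i != ord0 & x \in Xs i.
  move=> xX; rewrite inE xX andbT negbK => /bigcupP[Z ZB xZ].
  by have [i i0 XsZ] := Xs_onto Z ZB; exists i; rewrite ?XsZ.
have Ys_nonnbr i y : i != ord0 -> y \in Ys i -> exists2 a, a \in Xs i & ~~ e y a.
  move=> i0; rewrite (YsE _ _ i0) negb_forall_in => /andP[_].
  by move/exists_inP.
have Ys_complete i j y x :
    i != j -> j != ord0 -> y \in Ys i -> x \in Xs j -> e y x.
  case: (eqVneq i ord0) => [->|i0] ij j0 yi xj.
    move: yi; rewrite Ys0 => /andP[_ /forall_inP yB].
    exact: (forall_inP (yB _ (XsB j j0))).
  have [a ai ya] := Ys_nonnbr i y i0 yi.
  exact: (nonnbr_once e_sym e_irr noP5 maxX (XsB i i0) (XsB j j0)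
            (Xs_neq i j i0 j0 ij) (YsY i y yi) ai ya xj).
have Xs_anti i j x x' : i != j -> x \in Xs i -> x' \in Xs j -> ~~ e x x'.
  case: (eqVneq i ord0) => [->|i0] ij xi xj.
    rewrite Xs0 in xi.
    exact: (isolated_anticomplete e_sym e_irr xi (XsX j _ xj)).
  case: (eqVneq j ord0) => [j0|j0].
    rewrite j0 Xs0 in xj; rewrite e_sym.
    exact: (isolated_anticomplete e_sym e_irr xj (XsX i _ xi)).
  exact: (bigcomp_anticomplete e_sym (XsB i i0) (XsB j j0) (Xs_neq i j i0 j0 ij)).
have Ys_adj i j y y' : i != j -> y \in Ys i -> y' \in Ys j -> e y y'.
  (* Of two distinct indices one is nonzero, say [k]: then [z] has a non-neighbour in [Xs k], to
     which [z'] is complete. *)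
  have adj k l z z' : k != ord0 -> k != l -> z \in Ys k -> z' \in Ys l -> e z z'.
    move=> k0 kl zk zl; have [a ak za] := Ys_nonnbr k z k0 zk.
    apply: (mixed_complete_adj e_sym e_irr noP5 no_coP5 maxX (XsB k k0)
      (YsY k z zk) (YsY l z' zl) ak za) => b bk.
    by apply: (Ys_complete l k) => //; rewrite eq_sym.
  case: (eqVneq i ord0) => [i0|i0] ij yi yj; last exact: (adj i j).
  by rewrite e_sym; apply: (adj j i); rewrite // -?i0 eq_sym.
have bX : \bigcup_(i < #|B|.+1) Xs i = X.
  apply/setP=> x; apply/bigcupP/idP=> [[i _]|xX]; first exact: XsX.
  case: (boolP (x \in X0)) => [xX0|/(coverB x xX)[i _ xi]]; last by exists i.
  by exists ord0; rewrite ?Xs0.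
have bY : \bigcup_(i < #|B|.+1) Ys i = Y.
  apply/setP=> y; apply/bigcupP/idP=> [[i _]|yY]; first exact: YsY.
  case: (boolP [forall Z in B, complete_to e y Z]) => [yB|].
    by exists ord0; rewrite ?Ys0 ?yY.
  rewrite negb_forall_in => /exists_inP[Z /Xs_onto[i i0 <-] yi].
  by exists i; rewrite ?YsE ?yY.
have Xs_two i : i != ord0 -> 1 < #|Xs i|.
  by move/(XsB i); rewrite inE => /andP[].
exists #|B|, Xs, Ys => /=; rewrite bX bY Xs0.
split; first exact: card_bigcomps maxX.
split=> [i j ij|].
  apply/pred0P=> x /=; apply/negP=> /andP[xi xj].
  have disj k l : k != ord0 -> k != l -> x \in Xs k -> x \in Xs l -> False.
    move=> k0 kl xk xl; case: (eqVneq l ord0) => [l0|l0].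
      move: xl; rewrite l0 Xs0 inE => /andP[/negP[]].
      by apply/bigcupP; exists (Xs k); rewrite ?XsB.
    case/eqP: (Xs_neq k l k0 l0 kl).
    by apply: (component_inj e_sym _ _ xk xl); apply: bigcomp_component;
      apply: XsB.
  case: (eqVneq i ord0) => [i0|i0]; last exact: (disj i j).
  by apply: (disj j i); rewrite // -?i0 eq_sym.
split=> [i j ij|].
  apply/pred0P=> y /=; apply/negP=> /andP[yi yj].
  (* A common vertex would be adjacent to itself. *)
  by have := Ys_adj i j y y ij yi yj; rewrite e_irr.
split=> [i j|].
  apply/pred0P=> x /=; apply/negP=> /andP[/XsX xX /YsY].
  by rewrite inE xX.
split; first exact: setUCr.
split.
  split=> [i i0|].
    split; last exact: Xs_two.
    exact: (component_connected e_sym (bigcomp_component (XsB i i0))).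
  split=> [|i j ij].
    apply/forall_inP=> x xX0; apply/forall_inP=> x' /setDP[xX' _].
    exact: (isolated_anticomplete e_sym e_irr xX0 xX').
  by apply/forall_inP=> x xi; apply/forall_inP=> x'; apply: Xs_anti ij xi.
have nX0 i x : i != ord0 -> x \in Xs i -> x \notin X0.
  move=> i0 xi; rewrite inE negb_and negbK; apply/orP; left.
  by apply/bigcupP; exists (Xs i); rewrite ?XsB.
split.
  split=> [i i0|]; last first.
    apply/forall_inP=> y y0.
    apply/forall_inP=> x /setDP[xX /(coverB x xX)[i i0 xi]].
    by apply: (Ys_complete ord0 i); rewrite // eq_sym.
  split=> [|y yi]; last first.
    split; last first.
      apply/forall_inP=> x /setDP[xX]; rewrite in_setU negb_or => /andP[nxi].
      case/(coverB x xX)=> j j0 xj; apply: (Ys_complete i j) => //.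
      by apply: contraNneq nxi => ->.
    apply/mixed_onP; split; last exact: Ys_nonnbr.
    exact: (bigcomp_nbr e_sym e_irr maxX (XsB i i0) (YsY i y yi)).
  (* Non-emptiness of [Ys i]: by primeness some [y] outside [Xs i] is mixed on it, and [y] is not in
     [X] because it would then belong to the component [Xs i]. *)
  have := e_prime (Xs i).
  have [x xi] := component_neq0 (bigcomp_component (XsB i i0)).
  have [Z ZB nZ] := other_bigcomp e_sym e_irr maxX (Xs i).
  have [j j0 XsZ] := Xs_onto Z ZB.
  have ij : i != j by apply: contraNneq nZ => ->; rewrite XsZ.
  have [x' xj] := component_neq0 (bigcomp_component ZB); rewrite -XsZ in xj.
  rewrite /proper_homogeneous Xs_two //=; have -> /= : Xs i != [set: V].
    apply/eqP=> XsT; have x'i : x' \in Xs i by rewrite XsT inE.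
    have [x2 x2j xx2] := bigcomp_edge e_sym (XsB j j0) xj.
    by case/negP: (Xs_anti i j x' x2 ij x'i x2j).
  rewrite andbT /homogeneous (_ : Xs i != set0) ?andTb;
    last by apply/set0Pn; exists x.
  rewrite negb_forall_in => /exists_inP[y yi]; rewrite negb_or => /andP[ncom].
  rewrite negb_forall_in => /exists_inP[z zi]; rewrite negbK => yz.
  apply/set0Pn; exists y; rewrite YsE // ncom andbT inE.
  apply/negP=> yX; move: yi; rewrite inE => /negP[].
  apply: (component_closed e_sym (bigcomp_component (XsB i i0)) zi yX).
  by rewrite e_sym.
split.
  split=> [i j ij|W WY].
    by apply/forall_inP=> y yi; apply/forall_inP=> y'; apply: Ys_adj ij yi.
  have [w wW] := component_neq0 WY.
  have: w \in \bigcup_(i < #|B|.+1) Ys i by rewrite bY (component_sub WY wW).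
  case/bigcupP=> i _ wi; exists i; apply/subsetP=> w' wW'.
  apply/negPn/negP=> nw'.
  (* Leaving [Ys i] inside [W] would need a non-edge to some other [Ys j]. *)
  have [u [v [uW vW /andP[_ uv] ui vi]]] :=
    component_cut (complement_sym e_sym) (P := mem (Ys i)) WY wW wW' wi nw'.
  have: v \in \bigcup_(i < #|B|.+1) Ys i by rewrite bY (component_sub WY vW).
  case/bigcupP=> j _ vj; case/negP: uv; apply: (Ys_adj i j) => //.
  by apply: contraNneq vi => ->.
split=> [x W /setDP[xX /(coverB x xX)[i i0 xi]] WY|].
  exact: (bigcomp_not_mixed e_sym e_irr noP5 no_coP5 noC5 maxX (XsB i i0) xi WY).
split=> [i i0|].
  have [x xi xY] :=
    bigcomp_complete_vertex e_sym e_irr noP5 no_coP5 noC5 maxX (XsB i i0).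
  by exists x => //; apply/forall_inP.
split=> [x _|].
  apply/card_le1_eqP=> W W'; rewrite !inE => /andP[WY mW] /andP[WY' mW'].
  exact: (mixed_once e_sym e_irr no_coP5 WY' WY mW' mW).
split.
  split=> [W WY bW|W W' WY bW WY' bW' nW].
    exact: (big_anticomponent_mixed e_sym e_irr noP5 no_coP5 noC5 maxX).
  apply/setP=> x; rewrite !inE; apply/negP=> /andP[/andP[_ mW] /andP[_ mW']].
  by case/eqP: nW; apply: (mixed_once e_sym e_irr no_coP5 WY WY' mW mW').
split=> [W WY bW|].
  exact: (anticomponent_anticomplete_vertex e_sym e_irr noP5 no_coP5 noC5 maxX).
case/(anticomponent_mixed_part_anticomplete e_sym e_irr no_coP5)=> W [WY bW minW].
exists W; split=> // Z ZYW bZ.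
(* [Z] lies in an anticomponent [W'] of [Y], which is big like [Z] and differs from [W] since [Z]
   avoids [W]. *)
have [W' WY' sZW] := component_subset (complement_sym e_sym) (subsetDl Y W) ZYW.
have [z zZ] := component_neq0 ZYW.
have nW : W != W'.
  have := component_sub ZYW zZ; rewrite inE => /andP[+ _].
  apply: contraNneq => ->.
  exact: (subsetP sZW).
have antiW := minW W' WY' (leq_trans bZ (subset_leq_card sZW)) nW.
apply/forall_inP=> x xM; apply/forall_inP=> z' zZ'.
exact: (forall_inP (forall_inP antiW x xM) z' (subsetP sZW z' zZ')).
Qed.
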